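(* Let $K_{1,n}$ be a directed edge-labeled star graph with $n\ge 1$ edges and with $k$ distinct edge labels. Then the associated Lie algebra $\mathfrak{n}_{K_{1,n}}$ has abelian factor of dimension $n-k$.
   Context: A directed edge-labeled graph $G=(V,E,C)$ is a finite connected directed graph with vertex set $V=\{v_1,\dots,v_n\}$ and edge set $E$, together with a surjective labeling $c:E\to C=\{Z_1,\dots,Z_p\}$ (labels may be repeated on different edges). An edge directed from $v$ to $w$ is written $(v,w)$. The Lie algebra $\mathfrak{n}_G$: as a real vector space $\mathfrak{n}_G=\mathfrak{v}\oplus\mathfrak{w}$, where $\mathfrak{v}$ has basis $V$ and $\mathfrak{w}$ has basis $C$. The bracket is bilinear and skew-symmetric with $[v_i,v_j]=\sum_{\ell}(\epsilon_\ell-\epsilon'_\ell)Z_\ell$, where $\epsilon_\ell=1$ if $c(v_i,v_j)=Z_\ell$ and $0$ otherwise, and $\epsilon'_\ell=1$ if $c(v_j,v_i)=Z_\ell$ and $0$ otherwise; all other brackets of basis elements are zero. For a simple graph the derived algebra is $[\mathfrak{n}_G,\mathfrak{n}_G]=\mathfrak{w}$. The abelian factor of $\mathfrak{n}_G$ is the unique subspace $\mathfrak{a}\subseteq\mathfrak{v}$ such that the center satisfies $\mathcal{Z}(\mathfrak{n}_G)=[\mathfrak{n}_G,\mathfrak{n}_G]\oplus\mathfrak{a}$. The star graph $K_{1,n}$ consists of a central vertex $v_0$ joined by one edge to each of $n$ end vertices; edges may be directed arbitrarily and labels may repeat. *)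

(* Defs.v *)
From HB Require Import structures.
From mathcomp Require Export all_boot all_order all_algebra.
From mathcomp Require Export reals.

Set Implicit Arguments.
Unset Strict Implicit.
Unset Printing Implicit Defensive.

Import GRing.Theory.
Local Open Scope ring_scope.

HB.mixin Record Vector_isLie (F : fieldType) L of Vector F L := {
  lieb : L -> L -> L;
  lieb_linearl : forall y, linear (lieb^~ y);
  lieb_linearr : forall x, linear (lieb x);
  lieb_alt : forall x, lieb x x = 0;
  lieb_jacobi : forall x y z,
    lieb x (lieb y z) + lieb y (lieb z x) + lieb z (lieb x y) = 0
}.

#[short(type="lieType")]
HB.structure Definition Lie (F : fieldType) :=
  {L of Vector_isLie F L & Vector F L}.

HB.instance Definition _ (F : fieldType) (L : lieType F) (x : L) :=
  GRing.isLinear.Build F L L _ (lieb x) (lieb_linearr x).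

Definition liebr (F : fieldType) (L : lieType F) (y x : L) : L := lieb x y.

HB.instance Definition _ (F : fieldType) (L : lieType F) (y : L) :=
  GRing.isLinear.Build F L L _ (liebr y) (lieb_linearl y).

Definition derived (F : fieldType) (L : lieType F) : {vspace L} :=
  <<[seq lieb x y | x <- vbasis {:L}, y <- vbasis {:L}]>>%VS.

Definition center (F : fieldType) (L : lieType F) : {vspace L} :=
  (\bigcap_i lker (linfun (liebr (tnth (vbasis {:L}) i))))%VS.

Lemma lieb_derived (F : fieldType) (L : lieType F) (x y : L) :
  lieb x y \in derived L.
Proof.
rewrite (coord_vbasis (memvf x)) (coord_vbasis (memvf y)).
rewrite -/(liebr _ _) linear_sum; apply: memv_suml => i _; rewrite linearZ /=.
apply: memvZ; rewrite /liebr linear_sum; apply: memv_suml => j _.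
rewrite linearZ; apply: memvZ; apply: memv_span.
by apply: allpairs_f; apply: mem_nth; rewrite size_tuple.
Qed.

Lemma derived_min (F : fieldType) (L : lieType F) (U : {vspace L}) :
  (forall x y, lieb x y \in U) -> (derived L <= U)%VS.
Proof. by move=> brU; apply/span_subvP => _ /allpairsP[p [_ _ ->]]. Qed.

Lemma centerP (F : fieldType) (L : lieType F) (x : L) :
  reflect (forall y, lieb x y = 0) (x \in center L).
Proof.
apply: (iffP subv_bigcapP) => [xC y | xC i _]; last first.
  by rewrite -memvE memv_ker lfunE /= /liebr xC.
rewrite (coord_vbasis (memvf y)) linear_sum big1 // => i _.
have:= xC i isT; rewrite -memvE memv_ker lfunE /= /liebr (tnth_nth 0) => /eqP xi0.
by rewrite linearZ /= xi0 scaler0.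
Qed.

(* Edges are ordered pairs, so loops and antiparallel edges are allowed here
   but parallel edges are not. *)
Record lgraph := LGraph {
  vert : finType;
  label : finType;
  edges : {set vert * vert};
  elabel : {e : vert * vert | e \in edges} -> label;
  elabel_surj : forall l, exists e, elabel e = l;
  vert_nonempty : (0 < #|vert|)%N;
  edges_connected : forall v w,
    connect [rel x y | ((x, y) \in edges) || ((y, x) \in edges)] v w
}.

Definition adj (G : lgraph) (v w : vert G) : bool :=
  ((v, w) \in edges G) || ((w, v) \in edges G).

Definition simple_graph (G : lgraph) : Prop :=
  forall v w : vert G, (v, w) \in edges G -> (w, v) \notin edges G.

Definition star_graph (n : nat) (G : lgraph) : Prop :=
  simple_graph G /\ #|vert G| = n.+1 /\
  exists v0 : vert G, forall v w, adj v w = (v == v0) (+) (w == v0).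

Definition eps (F : fieldType) (G : lgraph) (v w : vert G) (l : label G) : F :=
  if insub (v, w) is Some e then (elabel e == l)%:R else 0.

(* Pairs of coordinate vectors: the first component is the part in v, the
   second the part in w. *)
Definition nG (F : fieldType) (G : lgraph) : Type :=
  ({ffun vert G -> F^o} * {ffun label G -> F^o})%type.

HB.instance Definition _ (F : fieldType) (G : lgraph) := Vector.on (nG F G).

Definition vbase (F : fieldType) (G : lgraph) (v : vert G) : nG F G :=
  ([ffun u => (u == v)%:R], 0).

Definition lbase (F : fieldType) (G : lgraph) (l : label G) : nG F G :=
  (0, [ffun m => (m == l)%:R]).

Definition bracket_base (F : fieldType) (G : lgraph) (v w : vert G) : nG F G :=
  \sum_(l : label G) (eps F v w l - eps F w v l) *: lbase F l.

Definition bracket (F : fieldType) (G : lgraph) (x y : nG F G) : nG F G :=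
  \sum_(v : vert G) \sum_(w : vert G) (x.1 v * y.1 w) *: bracket_base F v w.

Lemma bracket_baseC (F : fieldType) (G : lgraph) (v w : vert G) :
  bracket_base F w v = - bracket_base F v w.
Proof. by rewrite -sumrN; apply: eq_bigr => l _; rewrite -scaleNr opprB. Qed.

Lemma bracket_base_diag (F : fieldType) (G : lgraph) (v : vert G) :
  bracket_base F v v = 0.
Proof. by apply: big1 => l _; rewrite subrr scale0r. Qed.

Lemma bracket_linearl (F : fieldType) (G : lgraph) (y : nG F G) :
  linear ((@bracket F G)^~ y).
Proof.
move=> a x z; rewrite /bracket scaler_sumr -big_split; apply: eq_bigr => v _.
rewrite scaler_sumr -big_split; apply: eq_bigr => w _ /=.
by rewrite !ffunE scalerA -scalerDl mulrDl mulrA.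
Qed.

Lemma bracketC (F : fieldType) (G : lgraph) (x y : nG F G) :
  bracket y x = - bracket x y.
Proof.
rewrite /bracket exchange_big -sumrN; apply: eq_bigr => v _.
rewrite -sumrN; apply: eq_bigr => w _.
by rewrite bracket_baseC scalerN mulrC.
Qed.

Lemma bracket_linearr (F : fieldType) (G : lgraph) (x : nG F G) :
  linear (@bracket F G x).
Proof.
move=> a y z; rewrite bracketC bracket_linearl.
by rewrite (bracketC x y) (bracketC x z) scalerN opprD !opprK.
Qed.

Lemma bracket_alt (F : fieldType) (G : lgraph) (x : nG F G) : bracket x x = 0.
Proof.
have scaleb v w (a : F) : a *: bracket_base F v w =
    \sum_(l : label G) (a * eps F v w l) *: lbase F l
    - \sum_(l : label G) (a * eps F w v l) *: lbase F l.
  rewrite scaler_sumr -sumrB; apply: eq_bigr => l _.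
  by rewrite scalerA mulrBr scalerBl.
rewrite /bracket; under eq_bigr do under eq_bigr do rewrite scaleb.
under eq_bigr do rewrite sumrB; rewrite sumrB; apply/eqP; rewrite subr_eq0.
rewrite exchange_big; apply/eqP; apply: eq_bigr => v _; apply: eq_bigr => w _.
by apply: eq_bigr => l _; rewrite [x.1 w * _]mulrC.
Qed.

Lemma bracket_fst (F : fieldType) (G : lgraph) (x y : nG F G) :
  (bracket x y).1 = 0.
Proof.
have fst_sum (I : finType) (u : I -> nG F G) :
    (forall i, (u i).1 = 0) -> (\sum_i u i).1 = 0.
  by move=> u0; elim/big_ind: _ => // a b /= -> ->; rewrite addr0.
apply: (fst_sum) => v; apply: (fst_sum) => w; rewrite /bracket_base /=.
by rewrite fst_sum ?scaler0 // => l; apply: scaler0.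
Qed.

Lemma bracket_jacobi (F : fieldType) (G : lgraph) (x y z : nG F G) :
  bracket x (bracket y z) + bracket y (bracket z x)
    + bracket z (bracket x y) = 0.
Proof.
have br0 (a b c : nG F G) : bracket a (bracket b c) = 0.
  rewrite {1}/bracket big1 // => v _; rewrite big1 // => w _.
  by rewrite bracket_fst ffunE mulr0 scale0r.
by rewrite !br0 !addr0.
Qed.

HB.instance Definition _ (F : fieldType) (G : lgraph) :=
  Vector_isLie.Build F (nG F G) (@bracket_linearl F G) (@bracket_linearr F G)
    (@bracket_alt F G) (@bracket_jacobi F G).

Definition vpart (F : fieldType) (G : lgraph) : {vspace nG F G} :=
  <<[seq vbase F v | v : vert G]>>%VS.

Definition abelian_factor (F : fieldType) (G : lgraph)
    (a : {vspace nG F G}) : Prop :=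
  [/\ (a <= vpart F G)%VS,
      center (nG F G) = (derived (nG F G) + a)%VS
    & directv (derived (nG F G) + a)%VS].

(* Main.v *)
From HB Require Import structures.
Require Import Defs.

Set Implicit Arguments.
Unset Strict Implicit.
Unset Printing Implicit Defensive.

Import GRing.Theory.
Local Open Scope ring_scope.

(** Let f = [v_0, -] be the bracket with the centre of the star. Two end
    vertices commute, so the whole bracket is governed by f: with x_0 the
    v_0-coordinate of x, [x, y] = x_0 f(y) - y_0 f(x) ([star_lieb]). Each
    edge joins v_0 to an end vertex, which f sends to plus or minus the label
    of that edge. As every label occurs, f maps the n-dimensional span of the
    end vertices onto the k-dimensional span w of the labels
    ([ad_hub_leaves]), and w is the derived algebra ([derived_star]).

    An element x is central exactly when x_0 = 0 and f(x) = 0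
    ([center_starP]). That x_0 must vanish is where an end vertex is needed:
    f is nonzero on it. Since f kills w, the centre is the direct sum of w and
    of the kernel of f on the span of the end vertices. So this kernel is an
    abelian factor, of dimension n - k by rank-nullity.

    Over any graph an abelian factor is unique ([abelian_factor_uniq]): it is
    the intersection of the centre with the span of the vertices. *)

(** * Coordinates and dimensions *)

(** The coordinate form c i vanishes on the span of the vectors b j, j != i,
    but not on b i, so no vector of the family lies in the span of others. *)

Lemma free_dual (F : fieldType) (V : vectType F) (I : eqType) (b : I -> V)
    (c : I -> 'Hom(V, F^o)) (s : seq I) :
  (forall i j, c i (b j) = (j == i)%:R) -> uniq s -> free [seq b i | i <- s].
Proof.
move=> cb; elim: s => [|i s IHs] /=; first by rewrite nil_free.
case/andP=> i_s uniq_s; rewrite free_cons IHs // andbT.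
apply/negP => bi_s.
have /subvP/(_ _ bi_s) : (<<[seq b j | j <- s]>> <= lker (c i))%VS.
  apply/span_subvP => _ /mapP[j j_s ->]; rewrite memv_ker cb.
  by have [ji | _] := eqVneq j i; [rewrite -ji j_s in i_s | rewrite eqxx].
by rewrite memv_ker cb eqxx oner_eq0.
Qed.

Definition vcoord (F : fieldType) (G : lgraph) (v : vert G) (x : nG F G) : F^o :=
  x.1 v.

Lemma vcoord_linear (F : fieldType) (G : lgraph) (v : vert G) :
  linear (@vcoord F G v).
Proof. by move=> a x y; rewrite /vcoord /= !ffunE. Qed.

HB.instance Definition _ (F : fieldType) (G : lgraph) (v : vert G) :=
  GRing.isLinear.Build F (nG F G) F^o _ (@vcoord F G v) (@vcoord_linear F G v).

Definition lcoord (F : fieldType) (G : lgraph) (l : label G) (x : nG F G) : F^o :=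
  x.2 l.

Lemma lcoord_linear (F : fieldType) (G : lgraph) (l : label G) :
  linear (@lcoord F G l).
Proof. by move=> a x y; rewrite /lcoord /= !ffunE. Qed.

HB.instance Definition _ (F : fieldType) (G : lgraph) (l : label G) :=
  GRing.isLinear.Build F (nG F G) F^o _ (@lcoord F G l) (@lcoord_linear F G l).

(** The summand w of labels: the derived algebra once every label is the
    bracket of two vertices. *)
Definition lpart (F : fieldType) (G : lgraph) : {vspace nG F G} :=
  <<[seq lbase F l | l : label G]>>%VS.

Section Coordinates.

Variables (F : fieldType) (G : lgraph).
Implicit Types (x y : nG F G) (v w : vert G) (l : label G).

Lemma vcoord_vbase v w : vcoord v (vbase F w) = (w == v)%:R.
Proof. by rewrite /vcoord ffunE eq_sym. Qed.

Lemma vcoord_lbase v l : vcoord v (lbase F l) = 0.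
Proof. by rewrite /vcoord ffunE. Qed.

Lemma lcoord_vbase l v : lcoord l (vbase F v) = 0.
Proof. by rewrite /lcoord ffunE. Qed.

Lemma lcoord_lbase l m : lcoord l (lbase F m) = (m == l)%:R.
Proof. by rewrite /lcoord ffunE eq_sym. Qed.

Lemma nG_ext x y :
  (forall v, vcoord v x = vcoord v y) -> (forall l, lcoord l x = lcoord l y) ->
  x = y.
Proof.
by case: x y => [x1 x2] [y1 y2] e1 e2; congr pair; apply/ffunP.
Qed.

Lemma nG_decomp x :
  x = \sum_v vcoord v x *: vbase F v + \sum_l lcoord l x *: lbase F l.
Proof.
apply: nG_ext => [v | l]; rewrite linearD !linear_sum /=.
- rewrite [X in _ + X]big1 => [|l _]; last by rewrite linearZ /= vcoord_lbase scaler0.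
  rewrite addr0 (bigD1 v) //= linearZ /= vcoord_vbase eqxx.
  rewrite big1 ?addr0 => [|w /negPf wv]; first by rewrite [RHS]mulr1.
  by rewrite linearZ /= vcoord_vbase wv scaler0.
- rewrite big1 => [|v _]; last by rewrite linearZ /= lcoord_vbase scaler0.
  rewrite add0r (bigD1 l) //= linearZ /= lcoord_lbase eqxx.
  rewrite big1 ?addr0 => [|m /negPf ml]; first by rewrite [RHS]mulr1.
  by rewrite linearZ /= lcoord_lbase ml scaler0.
Qed.

Lemma vspanP (A : {pred vert G}) x :
  reflect ((forall v, v \notin A -> vcoord v x = 0) /\ forall l, lcoord l x = 0)
    (x \in <<[seq vbase F v | v in A]>>%VS).
Proof.
apply: (iffP idP) => [xA | [xA xl]].
- have ker (c : {linear nG F G -> F^o}) :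
      (forall v, v \in A -> c (vbase F v) = 0) -> c x = 0.
    move=> cA; have /subvP/(_ _ xA) :
        (<<[seq vbase F v | v in A]>> <= lker (linfun c))%VS.
      by apply/span_subvP => _ /imageP[v vA ->]; rewrite memv_ker lfunE /= cA.
    by rewrite memv_ker lfunE => /eqP.
  split=> [v vA | l]; apply: ker => w wA; last exact: lcoord_vbase.
  by rewrite /= vcoord_vbase; case: eqP wA vA => // -> ->.
- rewrite (nG_decomp x) [X in _ + X]big1 ?addr0 => [|l _]; last first.
    by rewrite xl scale0r.
  apply: memv_suml => v _; have [vA | vA] := boolP (v \in A).
    by apply/memvZ/memv_span/image_f.
  by rewrite xA // scale0r mem0v.
Qed.

Lemma dim_vspan (A : {pred vert G}) :
  \dim <<[seq vbase F v | v in A]>> = #|A|.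
Proof.
have /eqP -> : free [seq vbase F v | v in A].
  apply: (@free_dual _ _ _ _ (fun v => linfun (vcoord v))) (enum_uniq A) => v w.
  by rewrite lfunE /= vcoord_vbase.
by rewrite size_image.
Qed.

Lemma vpartP x : reflect (forall l, lcoord l x = 0) (x \in vpart F G).
Proof. by apply: (iffP (vspanP predT x)) => [[] | xl]. Qed.

Lemma lpartP x : reflect (forall v, vcoord v x = 0) (x \in lpart F G).
Proof.
apply: (iffP idP) => [xL v | xv].
- have /subvP/(_ _ xL) : (lpart F G <= lker (linfun (vcoord v)))%VS.
    by apply/span_subvP => _ /imageP[l _ ->]; rewrite memv_ker lfunE /= vcoord_lbase.
  by rewrite memv_ker lfunE => /eqP.
- rewrite (nG_decomp x) big1 => [|v _]; last by rewrite xv scale0r.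
  by rewrite add0r; apply: memv_suml => l _; apply/memvZ/memv_span/image_f.
Qed.

Lemma dim_lpart : \dim (lpart F G) = #|label G|.
Proof.
have /eqP -> : free [seq lbase F l | l : label G].
  apply: (@free_dual _ _ _ _ (fun l => linfun (lcoord l))) (enum_uniq _) => l m.
  by rewrite lfunE /= lcoord_lbase.
by rewrite size_image.
Qed.

Lemma capv_lpart_vpart : (lpart F G :&: vpart F G = 0)%VS.
Proof.
apply/eqP; rewrite -subv0; apply/subvP => x.
rewrite memv_cap memv0 => /andP[/lpartP xv /vpartP xl].
by apply/eqP/nG_ext => i; rewrite linear0.
Qed.

Lemma derived_lpart : (derived (nG F G) <= lpart F G)%VS.
Proof.
apply: derived_min => x y; apply/lpartP => v.
by rewrite /vcoord bracket_fst ffunE.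
Qed.

Lemma lieb_lpartr x y : y \in lpart F G -> lieb x y = 0.
Proof.
move/lpartP=> yv; rewrite [lieb _ _]/(bracket _ _) /bracket big1 // => v _.
by rewrite big1 // => w _; rewrite [y.1 w]yv mulr0 scale0r.
Qed.

Lemma lieb_vbase v w : lieb (vbase F v) (vbase F w) = bracket_base F v w.
Proof.
rewrite [lieb _ _]/(bracket _ _) /bracket (bigD1 v) //= (bigD1 w) //=.
rewrite !ffunE !eqxx mulr1 scale1r big1 => [|w' /negPf w'w]; last first.
  by rewrite !ffunE w'w mulr0 scale0r.
rewrite big1 ?addr0 // => v' /negPf v'v; apply: big1 => w' _.
by rewrite !ffunE v'v mul0r scale0r.
Qed.

Lemma bracket_base_nadj v w : ~~ adj v w -> bracket_base F v w = 0.
Proof.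
rewrite negb_or => /andP[vw wv]; apply: big1 => l _.
by rewrite /eps !insubN // subrr scale0r.
Qed.

Lemma bracket_base_edge v w (vw : (v, w) \in edges G) :
  (w, v) \notin edges G ->
  bracket_base F v w = lbase F (elabel (exist _ (v, w) vw)).
Proof.
move=> wv; rewrite /bracket_base (bigD1 (elabel (exist _ (v, w) vw))) //=.
rewrite /eps (insubT (fun e => e \in edges G) vw) insubN //= eqxx subr0.
rewrite scale1r big1 ?addr0 // => l /negPf lvw.
by rewrite eq_sym lvw subr0 scale0r.
Qed.

Lemma lbase_neq0 l : lbase F l != 0.
Proof.
apply: contra_neq (@oner_neq0 F) => l0.
by have := lcoord_lbase l l; rewrite l0 linear0 eqxx => /esym.
Qed.

(** Suppose x lies in one abelian factor. It is central, so it is d + u with d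
    in the derived algebra and u in the other factor. Then d = x - u is a
    combination of labels and also one of vertices, hence zero. *)
Lemma abelian_factor_uniq (a a' : {vspace nG F G}) :
  abelian_factor a -> abelian_factor a' -> a = a'.
Proof.
have sub (b b' : {vspace nG F G}) :
    abelian_factor b -> abelian_factor b' -> (b <= b')%VS.
  move=> [bv cb _] [b'v cb' _]; apply/subvP => x xb.
  have : x \in center (nG F G) by rewrite cb -[x]add0r memv_add ?mem0v.
  rewrite cb' => /memv_addP[d dD [u ub' xdu]].
  suff /eqP d0 : d == 0 by rewrite xdu d0 add0r.
  rewrite -memv0 -capv_lpart_vpart memv_cap (subvP derived_lpart _ dD) /=.
  by rewrite -[d](addrK u) -xdu memvB ?(subvP bv x) ?(subvP b'v u).
by move=> ha ha'; apply/eqP; rewrite eqEsubv !sub.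
Qed.

End Coordinates.

(** * The Lie algebra of a star *)

Section Star.

Variables (F : fieldType) (G : lgraph) (v0 : vert G).
Hypothesis simpleG : simple_graph G.
Hypothesis starG : forall v w, adj v w = (v == v0) (+) (w == v0).
Implicit Types (x y : nG F G).

Local Notation ad_hub := (linfun (lieb (vbase F v0))).
Local Notation leaves := (<<[seq vbase F v | v in predC1 v0]>>%VS).

Lemma ad_hub_lpart x : x \in lpart F G -> ad_hub x = 0.
Proof. by move=> xL; rewrite lfunE /= lieb_lpartr. Qed.

Lemma ad_hub_sum x : ad_hub x = \sum_w vcoord w x *: bracket_base F v0 w.
Proof.
rewrite {1}(nG_decomp x) linearD [X in _ + X]ad_hub_lpart /=; last first.
  by apply: memv_suml => l _; apply/memvZ/memv_span/image_f.
rewrite addr0 linear_sum; apply: eq_bigr => w _.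
by rewrite linearZ /= lfunE /= lieb_vbase.
Qed.

(** Of the double sum over pairs of vertices, only the pairs with exactly one
    entry v0 survive: pairs of end vertices are not adjacent, and the
    bracket of v0 with itself is zero. *)
Lemma star_lieb x y : lieb x y = vcoord v0 x *: ad_hub y - vcoord v0 y *: ad_hub x.
Proof.
rewrite !ad_hub_sum [lieb x y]/(bracket x y) /bracket (bigD1 v0) //=.
rewrite scaler_sumr; congr (_ + _).
  by apply: eq_bigr => w _; rewrite scalerA.
rewrite scaler_sumr [in RHS](bigD1 v0) //= bracket_base_diag !scaler0 add0r -sumrN.
apply: eq_bigr => v /negPf vv0; rewrite (bigD1 v0) //= big1 ?addr0.
  by rewrite bracket_baseC scalerN scalerA mulrC.
move=> w /negPf wv0; rewrite bracket_base_nadj ?scaler0 //.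
by rewrite starG vv0 wv0.
Qed.

(** Every label is carried by an edge between v0 and some end vertex u, and
    is then the bracket of v0 with u, up to a sign given by the direction. *)
Lemma lpart_sub_ad_hub : (lpart F G <= ad_hub @: leaves)%VS.
Proof.
apply/span_subvP => _ /imageP[l _ ->].
have [[[v w] vw] <-] := elabel_surj l.
have inL u : u != v0 -> bracket_base F v0 u \in (ad_hub @: leaves)%VS.
  move=> uv0; rewrite -lieb_vbase.
  have -> : lieb (vbase F v0) (vbase F u) = ad_hub (vbase F u) by rewrite lfunE.
  by apply/memv_img/memv_span/image_f.
rewrite -(bracket_base_edge F vw (simpleG vw)).
have := starG v w; rewrite /adj vw /=.
have [-> | vv0] := eqVneq v v0; have [-> | wv0] := eqVneq w v0 => //= _.
  exact: inL.
by rewrite bracket_baseC rpredN; apply: inL.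
Qed.

Lemma ad_hub_derived : (ad_hub @: leaves <= derived (nG F G))%VS.
Proof. by apply/subvP => _ /memv_imgP[x _ ->]; rewrite lfunE lieb_derived. Qed.

Lemma derived_star : derived (nG F G) = lpart F G.
Proof.
apply/eqP; rewrite eqEsubv derived_lpart.
exact: subv_trans lpart_sub_ad_hub ad_hub_derived.
Qed.

Lemma ad_hub_leaves : (ad_hub @: leaves = lpart F G)%VS.
Proof. by apply/eqP; rewrite eqEsubv lpart_sub_ad_hub -derived_star ad_hub_derived. Qed.

Hypothesis leafG : exists u, u != v0.

(** For x central, [v0, x] = 0 gives ad_hub x = 0. The formula [star_lieb] for
    the bracket with an end vertex u then reduces to x_0 (ad_hub u) = 0, and
    ad_hub u is a label up to sign, so x_0 = 0. *)
Lemma center_starP x :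
  reflect (vcoord v0 x = 0 /\ ad_hub x = 0) (x \in center (nG F G)).
Proof.
apply: (iffP (centerP x)) => [xC | [x0 fx0] y]; last first.
  by rewrite star_lieb x0 fx0 scale0r scaler0 subr0.
have fx0 : ad_hub x = 0.
  by rewrite lfunE /= [lieb _ _]bracketC [bracket _ _]xC oppr0.
split=> //; have [u uv0] := leafG.
have /eqP := xC (vbase F u); rewrite star_lieb fx0 scaler0 subr0 scaler_eq0.
case/orP=> /eqP // fu0.
have : adj v0 u by rewrite starG eqxx (negPf uv0).
move: fu0; rewrite lfunE /= lieb_vbase => fu0 /orP[v0u | uv0E].
- have := bracket_base_edge F v0u (simpleG v0u).
  by rewrite fu0 => /esym/eqP; rewrite (negPf (lbase_neq0 F _)).
- have := bracket_base_edge F uv0E (simpleG uv0E).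
  by rewrite bracket_baseC fu0 oppr0 => /esym/eqP; rewrite (negPf (lbase_neq0 F _)).
Qed.

(** The label part of a central x lies in the derived algebra and is killed by
    ad_hub, as x itself is, so the vertex part of x is killed too; and it
    lies on the end vertices because x has no v0-coordinate. *)
Lemma abelian_factor_star : abelian_factor (leaves :&: lker ad_hub)%VS.
Proof.
have leaves_vpart : (leaves :&: lker ad_hub <= vpart F G)%VS.
  apply/subvP => x; rewrite memv_cap => /andP[/vspanP[_ xl] _].
  exact/vpartP.
split=> //; last first.
  apply/directv_addP/eqP; rewrite -subv0 -capv_lpart_vpart.
  exact: capvS (derived_lpart F G) leaves_vpart.
rewrite derived_star; apply/eqP; rewrite eqEsubv subv_add; apply/and3P; split.
- apply/subvP => x /center_starP[x0 fx0].
  have xL : \sum_l lcoord l x *: lbase F l \in lpart F G.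
    by apply: memv_suml => l _; apply/memvZ/memv_span/image_f.
  rewrite {1}(nG_decomp x) addrC memv_add // memv_cap memv_ker.
  apply/andP; split.
    apply: memv_suml => v _; have [-> | vv0] := eqVneq v v0.
      by rewrite x0 scale0r mem0v.
    by apply/memvZ/memv_span/image_f.
  have := fx0; rewrite {1}(nG_decomp x) linearD [X in _ + X]ad_hub_lpart //=.
  by rewrite addr0 => ->.
- apply/subvP => x xL; apply/center_starP.
  by split; [apply: (lpartP x xL) | apply: ad_hub_lpart].
- apply/subvP => x; rewrite memv_cap memv_ker => /andP[/vspanP[xv _] /eqP fx0].
  by apply/center_starP; split=> //; apply: xv; rewrite inE eqxx.
Qed.

Lemma dim_abelian_factor_star :
  \dim (leaves :&: lker ad_hub) = (#|vert G|.-1 - #|label G|)%N.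
Proof.
have := limg_ker_dim ad_hub leaves; rewrite ad_hub_leaves dim_lpart.
rewrite dim_vspan cardC1 => <-; exact: esym (addnK _ _).
Qed.

End Star.

Theorem theorem3p2 (R : realType) (G : lgraph) (n k : nat) :
  (1 <= n)%N -> star_graph n G -> #|label G| = k ->
  exists2 a : {vspace nG R G}, unique (@abelian_factor R G) a
    & \dim a = (n - k)%N.
Proof.
move=> n_gt0 [simpleG [cardG [v0 starG]]] <-.
have leafG : exists u : vert G, u != v0.
  by apply/card_gt0P; rewrite cardC1 cardG.
exists (<<[seq vbase R v | v in predC1 v0]>> :&: lker (linfun (lieb (vbase R v0))))%VS.
  split=> [|a' a'P]; first exact: abelian_factor_star.
  by apply: abelian_factor_uniq => //; apply: abelian_factor_star.
by rewrite dim_abelian_factor_star // cardG.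
Qed.
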